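(* Let $\rho,\sigma,\Delta>0$, $b\ge0$, and for $c>0$ let $\underline{x}(c)=x_v-\bar y(c)$ and $\bar x(c)=x_v+\bar y(c)$ be the boundaries of the continuation region, as defined in the context. With $C=\sqrt[4]{6\sigma^2/\alpha}$, the following asymptotic estimates hold as $c\to0^+$: $$\underline{x}(c)=x_v-C\sqrt[4]{c}+o(\sqrt[4]{c}),\qquad \bar x(c)=x_v+C\sqrt[4]{c}+o(\sqrt[4]{c}),$$ i.e. $x_v-\underline{x}(c)\sim C\sqrt[4]{c}$ and $\bar x(c)-x_v\sim C\sqrt[4]{c}$ as $c\to0^+$. In particular, $$\lim_{c\to0^+}\underline{x}(c)=\lim_{c\to0^+}\bar x(c)=x_v.$$
   Context: Constants: $$\alpha=\frac{\Delta+b}{\Delta^2},\quad x_v=\frac{\Delta(\Delta+2b)}{2(\Delta+b)},\quad \theta=\sqrt{\frac{2\rho}{\sigma^2}},\quad k_2=\frac{\alpha}{\rho}.$$ For $y>0$ let $$\xi(y)=k_2y^2-\frac{2k_2}{\theta}\,\frac{e^{\theta y}+e^{-\theta y}-2}{e^{\theta y}-e^{-\theta y}}\,y,$$ and for $c>0$ let $\bar y(c)>0$ be the unique solution of $\xi(\bar y(c))=c$. Set $\bar c=\xi(\Delta-x_v)$. Interpretation of $]\underline{x}(c),\bar x(c)[$: for $0<c<\bar c$ it is the continuation region of the impulse control problem $V^c(x)=\sup_{u}\mathbb{E}_x[\int_0^\infty e^{-\rho t}R(X_t^{x;u})dt-\sum_{k\ge1}e^{-\rho\tau_k}c]$, where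 $u=\{(\tau_k,\delta_k)\}_{k\ge1}$ ranges over impulse controls (stopping times $0\le\tau_k\le\tau_{k+1}\le+\infty$ for the natural filtration of a Brownian motion $W$ with $\tau_k\to+\infty$ and $\mathbb{E}_x[\sum_k e^{-\rho\tau_k}]<\infty$, and $\mathcal{F}_{\tau_k}$-measurable real $\delta_k$), $X_t^{x;u}=x-\sigma W_t+\sum_{\tau_k\le t}\delta_k$, $R(x)=x\Phi(x)-b\Phi(x)^2$, and $\Phi(x)=1$ for $x\le0$, $\Phi(x)=1-x/\Delta$ for $0<x<\Delta$, $\Phi(x)=0$ for $x\ge\Delta$; that is, $]\underline{x}(c),\bar x(c)[\,=\{x: \sup V^c-c<V^c(x)\}$. *)

(* Defs.v *)
From mathcomp Require Import all_boot all_order all_algebra.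
From mathcomp Require Import all_classical all_reals all_analysis.
From mathcomp Require Import ring lra.

Set Implicit Arguments.
Unset Strict Implicit.
Unset Printing Implicit Defensive.

Import Order.TTheory GRing.Theory Num.Theory.
Import numFieldNormedType.Exports.

Local Open Scope classical_set_scope.
Local Open Scope ring_scope.

Definition alpha {R : realType} (Delta b : R) : R := (Delta + b) / Delta ^+ 2.

Definition x_v {R : realType} (Delta b : R) : R :=
  Delta * (Delta + 2 * b) / (2 * (Delta + b)).

Definition theta {R : realType} (rho sigma : R) : R :=
  Num.sqrt (2 * rho / sigma ^+ 2).

Definition k2 {R : realType} (rho Delta b : R) : R := alpha Delta b / rho.

Definition xi {R : realType} (rho sigma Delta b y : R) : R :=
  let k := k2 rho Delta b in
  let t := theta rho sigma in
  k * y ^+ 2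
  - 2 * k / t
    * ((expR (t * y) + expR (- (t * y)) - 2) / (expR (t * y) - expR (- (t * y))))
    * y.

(* The unique positive solution of [xi y = c]; see [xi_root_unique] and
   [ybarP] below. *)
Definition ybar {R : realType} (rho sigma Delta b c : R) : R :=
  get [set y : R | 0 < y /\ xi rho sigma Delta b y = c].

(* Endpoints, for fixed cost [c] of an intervention, of the continuation region
   of the impulse control problem (that region is ]x_low, x_high[ whenever
   [c < xi (Delta - x_v)]); they are defined for every [c > 0] by these
   formulas. *)
Definition x_low {R : realType} (rho sigma Delta b c : R) : R :=
  x_v Delta b - ybar rho sigma Delta b c.

Definition x_high {R : realType} (rho sigma Delta b c : R) : R :=
  x_v Delta b + ybar rho sigma Delta b c.

(* [powR] is the usual fourth root on [0, +oo[, the only range used; its value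
   on negative reals is a junk value. *)
Definition fourth_root {R : realType} (x : R) : R := x `^ 4^-1.

Section WellPosed.
Variable R : realType.
Implicit Types (t y c k : R).

Let g t y : R := y - 2 / t * (1 - 2 / (expR (t * y) + 1)).
Let dg t y : R := 1 - 4 * expR (t * y) / (expR (t * y) + 1) ^+ 2.

Let E1_neq0 y : expR y + 1 != 0.
Proof. by rewrite gt_eqF// addr_gt0// expR_gt0. Qed.

Let is_derive_g t y : t != 0 -> is_derive y 1 (g t) (dg t y).
Proof.
move=> t0; rewrite /g /dg.
have dE : is_derive y 1 (fun z : R => expR (t * z) + 1) (expR (t * y) * t).
  have dl : is_derive y 1 (fun z : R => t * z) t.
    have h : is_derive y 1 (t *: (id : R -> R)) (t *: (1 : R)) by apply: is_deriveZ.
    by apply: (is_derive_eq h); rewrite /GRing.scale/= mulr1.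
  have de : is_derive y 1 (fun z : R => expR (t * z)) (expR (t * y) * t).
    exact: is_derive1_comp.
  have h := is_deriveD de (is_derive_cst (1 : R) y 1).
  by apply: (is_derive_eq h); rewrite addr0.
have dV := @is_deriveV R (fun z => expR (t * z) + 1) y _ _ (E1_neq0 (t * y)) dE.
have dC (a : R) := is_derive_cst a y (1 : R).
have H := is_deriveB (is_derive_id y (1 : R))
  (is_deriveZ (2 / t) (is_deriveB (dC 1) (is_deriveZ 2 dV))).
apply: (is_derive_eq H).
rewrite /GRing.scale/=.
have := E1_neq0 (t * y).
by move=> h; field; rewrite t0 h.
Qed.

Let dg_gt0 t y : 0 < t -> 0 < y -> 0 < dg t y.
Proof.
move=> t0 y0; rewrite /dg subr_gt0 ltr_pdivrMr ?exprn_gt0 ?addr_gt0 ?expR_gt0//.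
have : 1 < expR (t * y) by rewrite expR_gt1 mulr_gt0.
by move=> e1; nra.
Qed.

Let continuous_g t : t != 0 -> continuous (g t).
Proof.
move=> t0 y; apply/differentiable_continuous/derivable1_diffP.
by have [] := is_derive_g y t0.
Qed.

Let g_lt t y1 y2 : 0 < t -> 0 <= y1 -> y1 < y2 -> g t y1 < g t y2.
Proof.
move=> t0 y10 y12.
have [||z /andP[z1 z2] e] := @MVT R (g t) (dg t) y1 y2 y12.
- by move=> x _; apply: is_derive_g; rewrite gt_eqF.
- by apply: continuous_subspaceT; apply: continuous_g; rewrite gt_eqF.
rewrite -subr_gt0 e; apply: mulr_gt0; last by rewrite subr_gt0.
apply: dg_gt0 => //.
by apply: (le_lt_trans y10); move: z1; rewrite bnd_simp.
Qed.

Let g0 t : g t 0 = 0.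
Proof. by rewrite /g mulr0 expR0 (_ : 2 / (1 + 1) = 1 :> R) ?subrr ?mulr0 ?subrr//; field. Qed.

Let g_ge t y : 0 < t -> y - 2 / t <= g t y.
Proof.
by move=> t0; rewrite /g lerD2l lerN2 ler_piMr ?divr_ge0 ?(ltW t0)//.
Qed.

Lemma xi_root_unique (rho sigma Delta b c : R) :
  0 < rho -> 0 < sigma -> 0 < Delta -> 0 <= b -> 0 < c ->
  exists! y, 0 < y /\ xi rho sigma Delta b y = c.
Proof.
move=> r0 s0 D0 b0 c0.
set k := k2 rho Delta b; set t := theta rho sigma.
have k0 : 0 < k by rewrite !divr_gt0 ?exprn_gt0// ltr_wpDr.
have t0 : 0 < t by rewrite sqrtr_gt0 divr_gt0 ?exprn_gt0 ?mulr_gt0.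
have xiE y : 0 < y -> xi rho sigma Delta b y = k * y * g t y.
  move=> y0; rewrite /xi -/k -/t /g expRN.
  have e1 : 1 < expR (t * y) by rewrite expR_gt1 mulr_gt0.
  have h1 : expR (t * y) - 1 != 0 by rewrite subr_eq0 gt_eqF.
  have h2 := E1_neq0 (t * y).
  have h0 : expR (t * y) != 0 by rewrite gt_eqF// expR_gt0.
  have h3 : expR (t * y) * expR (t * y) - 1 != 0.
    by rewrite -expr2 subr_sqr_1 mulf_neq0.
  by field; rewrite h0 h2 h3 gt_eqF.
have F_lt y1 y2 : 0 < y1 -> y1 < y2 -> k * y1 * g t y1 < k * y2 * g t y2.
  move=> y10 y12; rewrite ltr_pM// ?ltr_pM2l ?g_lt ?ltW//.
  - by rewrite mulr_gt0.
  - by rewrite -(g0 t) g_lt.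
pose M := 2 / t + 1 + c / k.
have ck0 : 0 < c / k by rewrite divr_gt0.
have t20 : 0 < 2 / t by rewrite divr_gt0.
have M1 : 1 <= M by rewrite /M; lra.
have M0 : 0 < M by lra.
have cM : c <= k * M * g t M.
  have h : c / k <= g t M by apply: le_trans (g_ge M t0); rewrite /M; lra.
  rewrite -mulrA -ler_pdivrMl// mulrC.
  by apply: (le_trans h); rewrite ler_peMl//; lra.
have [||y /andP[y0 _] yc] := @IVT R (fun y => k * y * g t y) 0 M c (ltW M0).
- apply: continuous_subspaceT => x.
  apply: cvgM; last by apply: continuous_g; rewrite gt_eqF.
  by apply: cvgM; [exact: cvg_cst | exact: cvg_id].
- have m : 0 <= k * M * g t M by rewrite (le_trans (ltW c0)).
  by rewrite g0 mulr0 (min_l m) (max_r m) (ltW c0) cM.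
have {}y0 : 0 < y.
  rewrite lt_neqAle; move: y0; rewrite bnd_simp => ->; rewrite andbT.
  apply/eqP => y0; move: yc; rewrite -y0 mulr0 mul0r => /eqP.
  by rewrite lt_eqF.
exists y; split=> [|z [z0]]; first by rewrite xiE.
rewrite xiE// => zc.
case: (ltgtP y z) => // yz.
- by have := F_lt _ _ y0 yz; rewrite yc zc ltxx.
- by have := F_lt _ _ z0 yz; rewrite yc zc ltxx.
Qed.

Lemma ybarP (rho sigma Delta b c : R) :
  0 < rho -> 0 < sigma -> 0 < Delta -> 0 <= b -> 0 < c ->
  0 < ybar rho sigma Delta b c /\
  xi rho sigma Delta b (ybar rho sigma Delta b c) = c.
Proof.
move=> r0 s0 D0 b0 c0.
have [y [hy _]] := xi_root_unique r0 s0 D0 b0 c0.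
by apply: (@getPex _ [set y | 0 < y /\ xi rho sigma Delta b y = c]); exists y.
Qed.

End WellPosed.

(* Main.v *)
Require Import Defs.
From mathcomp Require Import all_boot all_order all_algebra.
From mathcomp Require Import all_classical all_reals all_analysis.
From mathcomp Require Import ring lra.

Set Implicit Arguments.
Unset Strict Implicit.
Unset Printing Implicit Defensive.

Import Order.TTheory GRing.Theory Num.Theory.
Import numFieldNormedType.Exports.

Local Open Scope classical_set_scope.
Local Open Scope ring_scope.

(** The formula for [xi] hides a hyperbolic tangent: with
    [k = alpha / rho] and [t = sqrt (2 * rho / sigma ^+ 2)],
    [xi y = k y^2 - (2 k / t) tanh (t y / 2) y] for [y > 0].  The expansion
    [tanh u = u - u^3/3 + O(u^5)] makes the quadratic terms cancel, and the
    quartic one that survives is [K y^4] with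
    [K = k t^2 / 12 = alpha / (6 sigma^2)].  Hence [xi y = c] forces
    [y ~ (c / K)^(1/4) = C c^(1/4)], which is where [C] comes from.

    To invert [xi] near 0, the expansion is turned into inequalities holding
    for every [y > 0],
    [K y^4 (1 - t^2 y^2 / 10) <= xi y <= K y^4] (lemmas [xi_ge], [xi_le]),
    deduced from Taylor bounds on [tanh].  Put [y = C c^(1/4)], so that
    [K y^4 = c].  Then [xi y <= c], while
    [xi ((1 + e) y) >= c (1 + e)^4 (1 - O(y^2)) >= c] once [c] is small.  By
    the intermediate value theorem [xi] takes the value [c] between [y] and
    [(1 + e) y], and by uniqueness of the solution this point is [ybar c]
    ([ybar_itv], [near_ybar]).  All the asymptotic statements follow from
    [y <= ybar c <= (1 + e) y]. *)

(** * Taylor bounds for the hyperbolic tangent *)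

Section Tanh.
Variable R : realType.
Implicit Types (f g : R -> R) (u x : R).

Definition tanh u : R := (expR u - expR (- u)) / (expR u + expR (- u)).

Lemma tanh0 : tanh 0 = 0.
Proof. by rewrite /tanh oppr0 subrr mul0r. Qed.

(** The form [1 - tanh^2] of the derivative turns a bound on [tanh] into a
    better bound on [tanh'], which is what drives the bounds below. *)
Lemma is_derive_tanh u : is_derive u 1 tanh (1 - tanh u ^+ 2).
Proof.
have h : expR u + expR (- u) != 0 by rewrite gt_eqF// addr_gt0// expR_gt0.
have dN : is_derive u 1 (fun x => expR (- x) : R) (- expR (- u)).
  have h1 : is_derive u 1 (-%R : R -> R) (- 1) by apply: is_deriveN.
  have h2 := @is_derive1_comp _ _ _ u _ _ (is_derive_expR (- u)) h1.
  by apply: (is_derive_eq h2); rewrite mulrN1.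
have d1 := is_deriveB (is_derive_expR u) dN.
have d2 := @is_deriveV _ (expR \+ (fun x => expR (- x))) u _ _ h
  (is_deriveD (is_derive_expR u) dN).
apply: (is_derive_eq (is_deriveM d1 d2)).
by rewrite !fctE /GRing.scale/= /tanh; field; rewrite h.
Qed.

Lemma continuous_tanh : continuous tanh.
Proof.
move=> u; apply/differentiable_continuous/derivable1_diffP.
by have [] := is_derive_tanh u.
Qed.

Lemma le_of_is_derive f g (f' g' : R -> R) :
  (forall x, is_derive x 1 f (f' x)) -> (forall x, is_derive x 1 g (g' x)) ->
  (forall x, 0 <= x -> f' x <= g' x) -> f 0 <= g 0 ->
  forall u, 0 <= u -> f u <= g u.
Proof.
move=> df dg fg' fg0 u; rewrite le_eqVlt => /predU1P[<-//|u0].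
have dh x : is_derive x 1 (g - f) (g' x - f' x) by apply: is_deriveB.
have [|z /andP[z0 _] e] :=
    @MVT R (g - f) (fun x => g' x - f' x) 0 u u0 (fun x _ => dh x).
  apply: continuous_subspaceT => x.
  apply/differentiable_continuous/derivable1_diffP.
  by have [] := dh x.
have z_ge0 : 0 <= z by move: z0; rewrite bnd_simp => /ltW.
have : 0 <= (g - f) u - (g - f) 0.
  by rewrite e subr0 mulr_ge0 ?(ltW u0)// subr_ge0 fg'.
rewrite !fctE; lra.
Qed.

Lemma tanh_ge0 u : 0 <= u -> 0 <= tanh u.
Proof.
move=> u0; apply: mulr_ge0; last by rewrite invr_ge0 addr_ge0// expR_ge0.
by rewrite subr_ge0 ler_expR; lra.
Qed.

Lemma tanh_le_id u : 0 <= u -> tanh u <= u.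
Proof.
apply: (le_of_is_derive is_derive_tanh (fun x => is_derive_id x (1 : R))).
- by move=> x _; have := sqr_ge0 (tanh x); lra.
- by rewrite tanh0.
Qed.

(** Integrate [tanh' = 1 - tanh^2 >= 1 - u^2], which comes from [tanh u <= u]. *)
Lemma tanh_ge_taylor3 u : 0 <= u -> u - u ^+ 3 / 3 <= tanh u.
Proof.
pose p x : R := x - x ^+ 3 / 3.
apply: (@le_of_is_derive p _ (fun x => 1 - x ^+ 2) _ _
  is_derive_tanh) => [x|x x0|].
- have -> : p = horner ('X - 3^-1 *: 'X^3).
    apply/funext => z; rewrite /p.
    by rewrite !(hornerD, hornerN, hornerZ, hornerXn, hornerX); field.
  apply: trigger_derive; rewrite !poly.derivE /=.
  by rewrite !(hornerD, hornerN, hornerZ, hornerM, hornerX, hornerC); field.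
- by have := tanh_le_id x0; have := tanh_ge0 x0; nra.
- by rewrite tanh0 /p; lra.
Qed.

(** Integrate [tanh' = 1 - tanh^2 <= 1 - (u - u^3/3)^2]. *)
Lemma tanh_le_taylor5 u :
  0 <= u -> tanh u <= u - u ^+ 3 / 3 + 2 / 15 * u ^+ 5.
Proof.
pose p x : R := x - x ^+ 3 / 3 + 2 / 15 * x ^+ 5.
apply: (@le_of_is_derive _ p _ (fun x => 1 - x ^+ 2 + 2 / 3 * x ^+ 4)
  is_derive_tanh) => [x|x x0|].
- have -> : p = horner ('X - 3^-1 *: 'X^3 + (2 / 15) *: 'X^5).
    apply/funext => z; rewrite /p.
    by rewrite !(hornerD, hornerN, hornerZ, hornerXn, hornerX); field.
  apply: trigger_derive; rewrite !poly.derivE /=.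
  by rewrite !(hornerD, hornerN, hornerZ, hornerM, hornerX, hornerC); field.
- (* The cubic lower bound can be squared only where it is nonnegative, that is
     for x^2 <= 3; beyond, the polynomial already exceeds 1. *)
  have [x3|x3] := leP (x ^+ 2) 3.
    have q0 : 0 <= x - x ^+ 3 / 3.
      have -> : x - x ^+ 3 / 3 = x * (1 - x ^+ 2 / 3) by field.
      by apply: mulr_ge0 => //; lra.
    have : (x - x ^+ 3 / 3) ^+ 2 <= tanh x ^+ 2.
      by rewrite ler_sqr ?nnegrE ?tanh_ge0// tanh_ge_taylor3.
    have : 0 <= (x ^+ 3) ^+ 2 by exact: sqr_ge0.
    have -> : (x - x ^+ 3 / 3) ^+ 2 =
        x ^+ 2 - 2 / 3 * x ^+ 4 + (x ^+ 3) ^+ 2 / 9 by field.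
    lra.
  have := sqr_ge0 (tanh x).
  have -> : x ^+ 4 = (x ^+ 2) ^+ 2 by ring.
  by nra.
- by rewrite tanh0 /p; lra.
Qed.

End Tanh.

(** * Fourth roots *)

Section FourthRoot.
Variable R : realType.
Implicit Types x : R.

Lemma fourth_root_gt0 x : 0 < x -> 0 < fourth_root x.
Proof. exact: powR_gt0. Qed.

Lemma fourth_rootK x : 0 <= x -> fourth_root x ^+ 4 = x.
Proof.
move=> x0; rewrite /fourth_root -powR_mulrn ?powR_ge0// -powRrM mulVf ?powRr1//.
Qed.

Lemma fourth_root_cvg0 : @fourth_root R x @[x --> 0^'+] --> (0 : R).
Proof. by apply: powR_cvg0; rewrite invr_gt0. Qed.

End FourthRoot.

(** * The root of [xi y = c] for small [c] *)

Section Root.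
Variables (R : realType) (rho sigma Delta b : R).
Hypotheses (hrho : 0 < rho) (hsigma : 0 < sigma) (hDelta : 0 < Delta)
  (hb : 0 <= b).
Implicit Types (y c e : R).

Let k := k2 rho Delta b.
Let t := theta rho sigma.
Let K := alpha Delta b / (6 * sigma ^+ 2).
Let C := fourth_root (6 * sigma ^+ 2 / alpha Delta b).
Local Notation xi := (xi rho sigma Delta b).
Local Notation ybar := (ybar rho sigma Delta b).

Let alpha_gt0 : 0 < alpha Delta b.
Proof. by rewrite divr_gt0 ?exprn_gt0// ltr_wpDr. Qed.

Let k_gt0 : 0 < k. Proof. by rewrite divr_gt0. Qed.

Let t_gt0 : 0 < t.
Proof. by rewrite sqrtr_gt0 divr_gt0 ?exprn_gt0 ?mulr_gt0. Qed.

Let K_gt0 : 0 < K.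
Proof. by rewrite divr_gt0// mulr_gt0// exprn_gt0. Qed.

Let KE : K = k * t ^+ 2 / 12.
Proof.
rewrite /t /theta sqr_sqrtr ?divr_ge0 ?sqr_ge0 ?mulr_ge0 ?ltW//.
rewrite /K /k /k2; field.
by rewrite !gt_eqF.
Qed.

Lemma xiE y : 0 < y -> xi y = k * y ^+ 2 - 2 * k / t * tanh (t / 2 * y) * y.
Proof.
move=> y0; rewrite /xi -/k -/t /tanh.
have e2 : t * y = t / 2 * y + t / 2 * y by field.
rewrite e2 !expRN expRD.
have : 1 < expR (t / 2 * y) by rewrite expR_gt1 !mulr_gt0 ?invr_gt0.
move: (expR _) => E E1.
have E0 : E != 0 by rewrite gt_eqF//; lra.
have EE1 : 1 < E * E by nra.
have h1 : E * E * (E * E) - 1 != 0 by rewrite subr_eq0 gt_eqF//; nra.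
have h2 : E * E + 1 != 0 by rewrite gt_eqF//; lra.
by field; rewrite E0 h1 h2 gt_eqF.
Qed.

(** Near 0 the bound is sharp: only terms of order [y^6] are lost. *)
Lemma xi_le y : 0 < y -> xi y <= K * y ^+ 4.
Proof.
move=> y0; rewrite xiE//.
have u0 : 0 <= t / 2 * y by rewrite !mulr_ge0 ?invr_ge0 ?ltW.
have h := tanh_ge_taylor3 u0.
have kt0 : 0 <= 2 * k / t * y by rewrite ltW// mulr_gt0// divr_gt0// mulr_gt0.
have -> : K * y ^+ 4 = k * y ^+ 2
   - 2 * k / t * y * (t / 2 * y - (t / 2 * y) ^+ 3 / 3).
  by rewrite KE; field; rewrite gt_eqF.
by rewrite (mulrAC _ (tanh _)) lerB//; exact: ler_wpM2l.
Qed.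

(** The factor [1 - t^2 y^2 / 10] is the quotient by [u^3/3] of
    [u^3/3 - 2 u^5/15], the fifth-order bound on [u - tanh u], at
    [u = t y / 2]. *)
Lemma xi_ge y : 0 < y -> K * y ^+ 4 * (1 - t ^+ 2 * y ^+ 2 / 10) <= xi y.
Proof.
move=> y0; rewrite xiE//.
have u0 : 0 <= t / 2 * y by rewrite !mulr_ge0 ?invr_ge0 ?ltW.
have h := tanh_le_taylor5 u0.
have kt0 : 0 <= 2 * k / t * y by rewrite ltW// mulr_gt0// divr_gt0// mulr_gt0.
have -> : K * y ^+ 4 * (1 - t ^+ 2 * y ^+ 2 / 10) = k * y ^+ 2
   - 2 * k / t * y *
     (t / 2 * y - (t / 2 * y) ^+ 3 / 3 + 2 / 15 * (t / 2 * y) ^+ 5).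
  by rewrite KE; field; rewrite gt_eqF.
by rewrite (mulrAC _ (tanh _)) lerB//; exact: ler_wpM2l.
Qed.

(** The intermediate value theorem yields a root between [y1] and [y2]; it is
    [ybar c] because the positive root is unique. *)
Lemma ybar_itv c y1 y2 : 0 < y1 -> y1 <= y2 -> xi y1 <= c <= xi y2 -> 0 < c ->
  y1 <= ybar c <= y2.
Proof.
move=> y10 y12 /andP[c1 c2] c0.
have y20 : 0 < y2 by exact: lt_le_trans y12.
pose F y := k * y ^+ 2 - 2 * k / t * tanh (t / 2 * y) * y.
have [||y /andP[yl yr] yc] := @IVT R F y1 y2 c y12.
- apply: continuous_subspaceT => x.
  apply: cvgB.
    by apply: cvgM; [exact: cvg_cst | exact: exprn_continuous].
  apply: cvgM; last exact: cvg_id.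
  apply: cvgM; first exact: cvg_cst.
  apply: (@continuous_comp _ _ _ ( *%R (t / 2)) (@tanh R)).
    exact: mulrl_continuous.
  exact: continuous_tanh.
- rewrite /F -!xiE//.
  by rewrite (min_l (le_trans c1 c2)) (max_r (le_trans c1 c2)) c1.
move: yl yr; rewrite !bnd_simp => yl yr.
have y0 : 0 < y by exact: lt_le_trans yl.
have [z [_ zu]] := xi_root_unique hrho hsigma hDelta hb c0.
rewrite -(zu _ (ybarP hrho hsigma hDelta hb c0)) (zu y) ?yl//.
by split=> //; rewrite xiE.
Qed.

Let invK_gt0 : 0 < 6 * sigma ^+ 2 / alpha Delta b.
Proof. by rewrite divr_gt0// mulr_gt0// exprn_gt0. Qed.

Lemma C_gt0 : 0 < C.
Proof. exact: fourth_root_gt0. Qed.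

(** The slack between [c] and [c (1 + e)^4] absorbs the relative error
    [t^2 y^2 / 10] of the quartic approximation as soon as [y] is small. *)
Lemma near_ybar e : 0 < e ->
  \forall c \near 0^'+,
    C * fourth_root c <= ybar c <= (1 + e) * (C * fourth_root c).
Proof.
move=> e0.
have small : \forall c \near 0^'+,
    t ^+ 2 * (1 + e) ^+ 3 / 10 * (C * fourth_root c) ^+ 2 <= e.
  have lim0 : t ^+ 2 * (1 + e) ^+ 3 / 10 * (C * fourth_root c) ^+ 2
      @[c --> 0^'+] --> (t ^+ 2 * (1 + e) ^+ 3 / 10 * (C * 0) ^+ 2 : R).
    apply: cvgMl_tmp; apply: (@continuous_cvg _ _ _ _ _ _ (fun x : R => x ^+ 2)).
      exact: exprn_continuous.
    by apply: cvgMl_tmp; exact: fourth_root_cvg0.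
  by apply: (cvgr_le _ lim0); rewrite mulr0 expr0n mulr0.
near=> c.
have c0 : 0 < c by near: c; exact: nbhs_right_gt.
have : t ^+ 2 * (1 + e) ^+ 3 / 10 * (C * fourth_root c) ^+ 2 <= e by near: c.
set y := C * fourth_root c => z_le.
have y0 : 0 < y by rewrite mulr_gt0 ?C_gt0 ?fourth_root_gt0.
have Ky : K * y ^+ 4 = c.
  rewrite exprMn (fourth_rootK (ltW invK_gt0)) (fourth_rootK (ltW c0)).
  by rewrite /K; field; rewrite !gt_eqF.
have ye : y <= (1 + e) * y by rewrite ler_peMl ?ltW//; lra.
apply: ybar_itv => //; rewrite -{1}Ky xi_le//=.
apply: le_trans (xi_ge (lt_le_trans y0 ye)).
set z := t ^+ 2 * ((1 + e) * y) ^+ 2 / 10.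
(* [z] is the relative error at [(1 + e) y]; [z (1 + e) <= e] amounts to
   [(1 + e) (1 - z) >= 1]. *)
have {}z_le : z * (1 + e) <= e by apply: le_trans z_le; rewrite /z; lra.
have -> : K * ((1 + e) * y) ^+ 4 = c * (1 + e) ^+ 4 by rewrite exprMn -Ky; ring.
rewrite -mulrA ler_peMr ?(ltW c0)//.
have -> : (1 + e) ^+ 4 * (1 - z) = (1 + e) ^+ 3 * ((1 + e) - z * (1 + e)) by ring.
by apply: mulr_ege1; [rewrite exprn_ege1//; lra | lra].
Unshelve. all: by end_near. Qed.

End Root.

Theorem proposition5p1 (R : realType) (rho sigma Delta b : R)
    (hrho : 0 < rho) (hsigma : 0 < sigma) (hDelta : 0 < Delta) (hb : 0 <= b) :
  let xv := x_v Delta b in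
  let xlow := x_low rho sigma Delta b in
  let xhigh := x_high rho sigma Delta b in
  let C := fourth_root (6 * sigma ^+ 2 / alpha Delta b) in
  [/\ xlow = (fun c => xv - C * fourth_root c) +o_ (0^'+) fourth_root,
      xhigh = (fun c => xv + C * fourth_root c) +o_ (0^'+) fourth_root,
      (fun c => xv - xlow c) ~_ (0^'+) (fun c => C * fourth_root c),
      (fun c => xhigh c - xv) ~_ (0^'+) (fun c => C * fourth_root c) &
      xlow c @[c --> 0^'+] --> xv /\ xhigh c @[c --> 0^'+] --> xv].
Proof.
move=> xv xlow xhigh C.
have C0 : 0 < C by exact: C_gt0.
have ybar_equiv e : 0 < e -> \forall c \near 0^'+,
    `|ybar rho sigma Delta b c - C * fourth_root c| <= e * (C * fourth_root c).
  move=> e0; near=> c.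
  suff : C * fourth_root c <= ybar rho sigma Delta b c
      <= (1 + e) * (C * fourth_root c).
    by move=> /andP[h1 h2]; rewrite ger0_norm; lra.
  near: c; exact: near_ybar.
have ybar_o e : 0 < e -> \forall c \near 0^'+,
    `|ybar rho sigma Delta b c - C * fourth_root c| <= e * `|fourth_root c|.
  move=> e0; near=> c.
  rewrite (ger0_norm (powR_ge0 _ _)).
  suff : `|ybar rho sigma Delta b c - C * fourth_root c|
      <= e / C * (C * fourth_root c) by rewrite mulrA divfK// gt_eqF.
  near: c; apply: ybar_equiv; exact: divr_gt0.
have ybar0 : ybar rho sigma Delta b c @[c --> 0^'+] --> (0 : R).
  have Cr0 a : a * (C * fourth_root c) @[c --> 0^'+] --> (0 : R).
    rewrite -[X in _ --> X](mulr0 (a * C)) /=.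
    under eq_cvg do rewrite mulrA.
    by apply: cvgMl_tmp; exact: fourth_root_cvg0.
  apply: (squeeze_cvgr _ (Cr0 1) (Cr0 (1 + 1))).
  by under eq_near do rewrite mul1r; exact: near_ybar.
have Cr_ge0 c : 0 <= C * fourth_root c by rewrite mulr_ge0 ?powR_ge0 ?(ltW C0).
have lowE c : xlow c = xv - ybar rho sigma Delta b c by [].
have highE c : xhigh c = xv + ybar rho sigma Delta b c by [].
split.
- apply/eqaddoP => e e0; near=> c; rewrite !fctE lowE.
  rewrite [X in `|X|](_ :
    _ = C * fourth_root c - ybar rho sigma Delta b c); last by ring.
  rewrite distrC.
  by near: c; exact: ybar_o.
- apply/eqaddoP => e e0; near=> c; rewrite !fctE highE.
  rewrite [X in `|X|](_ :
    _ = ybar rho sigma Delta b c - C * fourth_root c); last by ring.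
  by near: c; exact: ybar_o.
- apply/eqaddoP => e e0; near=> c; rewrite !fctE lowE subKr.
  rewrite (ger0_norm (Cr_ge0 c)).
  by near: c; exact: ybar_equiv.
- apply/eqaddoP => e e0; near=> c; rewrite !fctE highE (addrC xv) addrK.
  rewrite (ger0_norm (Cr_ge0 c)).
  by near: c; exact: ybar_equiv.
- split.
    by rewrite -[X in _ --> X]subr0; apply: cvgB; [exact: cvg_cst | exact: ybar0].
  by rewrite -[X in _ --> X]addr0; apply: cvgD; [exact: cvg_cst | exact: ybar0].
Unshelve. all: by end_near. Qed.
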